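(* Let $q$ be a power of an odd prime, $R=\mathbf{F}_q[T]$, $k=\mathbf{F}_q(T)$. Let $a\in R\setminus\mathbf{F}_q$ be such that $A=2a+1$ is monic, and let $m$ be any positive integer. Let $D\in R$ be one of the following polynomials: (1) $D=(A^m+a)^2+A$; (2) $D=(A^m-a)^2+A$; (3) $D=(A^m+a+1)^2-A$; (4) $D=(A^m-a-1)^2-A$. Assume that $D$ is square-free, that $K=k(\sqrt{D})$ is a real quadratic function field (i.e. $D$ is monic of even degree), and that $P\in R$ is an irreducible polynomial splitting in $K$. Then, in each of the cases (1)–(4), the ideal class number $h(D)$ of $K$ satisfies $$h(D)\ge \frac{\deg A}{\deg P}.$$
   Context: The ring of integers $\mathcal{O}_K$ of $K$ is the integral closure of $R=\mathbf{F}_q[T]$ in $K$. The ideal class number $h(D)=h(K)$ is the order of the group of fractional ideals of $\mathcal{O}_K$ modulo principal fractional ideals. $K=k(\sqrt{D})$ is called a real quadratic function field when $D$ is monic of even degree and not a square. An irreducible $P\in R$ splits in $K$ if $P\mathcal{O}_K=\wp\overline{\wp}$ with $\wp\neq\overline{\wp}$ prime ideals of $\mathcal{O}_K$.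
   Formalization: Case (1) with characteristic 3 and m=1 is excluded: there D=A+1 and the bound fails, e.g. q=3, a=2T^2+1, A=T^2, D=T^2+1, P=T has h(D)=1 while deg A/deg P=2. *)

(* Defs.v *)
(* MathComp, with the classical sets of MathComp-Analysis. *)
From HB Require Import structures.
From mathcomp Require Import all_boot all_order all_algebra all_field.
From mathcomp Require Import finmap boolp classical_sets cardinality.

Set Implicit Arguments.
Unset Strict Implicit.
Unset Printing Implicit Defensive.

Import GRing.Theory.

Local Open Scope ring_scope.

Definition deg (F : fieldType) (p : {poly F}) : nat := (size p).-1.

(* 0 is not square-free: it is divisible by every square. *)
Definition squarefree (F : fieldType) (D : {poly F}) : Prop :=
  forall Q : {poly F}, Q ^+ 2 %| D -> size Q = 1%N.

Definition real_quadratic (F : fieldType) (D : {poly F}) : Prop :=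
  [/\ D \is monic, ~~ odd (deg D) & ~ exists Q : {poly F}, D = Q ^+ 2].

Section QuadraticField.
Local Open Scope classical_set_scope.
Variables (F : fieldType) (K : fieldExtType {fraction {poly F}}).
Implicit Types (x y : K) (I J p : set K).

(* The inclusion of F[T] in K. *)
Definition polyK (f : {poly F}) : K := (tofrac f)%:A.

(* K = F(T)(s) with s a square root of D. *)
Definition generated_by_sqrt (D : {poly F}) (s : K) : Prop :=
  s ^+ 2 = polyK D /\ <<1; s>>%VS = fullv.

Definition OK : set K := [set x | integralOver polyK x].

Definition OK_submodule I : Prop :=
  [/\ I 0, forall x y, I x -> I y -> I (x + y)
    & forall a x, OK a -> I x -> I (a * x)].

(* Fractional ideals are nonzero. *)
Definition fractional_ideal I : Prop :=
  [/\ OK_submodule I, exists2 x, I x & x != 0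
    & exists2 d, OK d & d != 0 /\ (forall x, I x -> OK (d * x))].

Definition principal x : set K := [set a * x | a in OK].

Definition ideal_mul I J : set K :=
  [set z | exists2 u : seq (K * K),
     (forall w, w \in u -> I w.1 /\ J w.2) & z = \sum_(w <- u) w.1 * w.2].

(* The coset of I modulo the subgroup of principal fractional ideals. *)
Definition ideal_class I : set (set K) :=
  [set ideal_mul I (principal x) | x in [set x | x != 0]].

Definition class_group : set (set (set K)) :=
  [set ideal_class I | I in fractional_ideal].

(* fset_set sends an infinite set to the empty set, so a positive lower bound
   on class_number includes the finiteness of class_group. *)
Definition class_number : nat := #|` fset_set class_group|.

Definition prime_ideal p : Prop :=
  [/\ OK_submodule p, p `<=` OK, ~ p 1
    & forall x y, OK x -> OK y -> p (x * y) -> p x \/ p y].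

(* The bar is the nontrivial automorphism sigma of K over F(T). *)
Definition splits (P : {poly F}) : Prop :=
  exists (sigma : 'End(K)) (p : set K),
    [/\ kAut 1 fullv sigma /\ sigma != \1%VF,
        prime_ideal p /\ prime_ideal (sigma @` p),
        p <> sigma @` p
      & principal (polyK P) = ideal_mul p (sigma @` p)].

End QuadraticField.

Arguments class_number {F} K.
Arguments splits {F} K P.

(* Main.v *)
Require Import Defs.
From HB Require Import structures.
From mathcomp Require Import all_boot all_order all_algebra all_field.
From mathcomp Require Import finmap boolp classical_sets cardinality.
From mathcomp Require Import zify ring.

(* Let d = deg A. The norm x^2 - D y^2 of O_K = R + R sqrt D is equivalent to a
   binary quadratic form lying in an explicit finite cycle of reduced forms whose
   outer coefficients are, up to constants, powers of A, hence constant or of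
   degree at least d. Descent along the cycle shows that a norm of degree less
   than d is a constant times g^2 with g dividing both x and y.

   Write P O_K = p p'. The class group is finite, so two of the h + 1 classes
   of p^0, ..., p^h coincide, and p^n is principal for some 0 < n <= h. Its
   generator has norm P^n up to a constant and is not divisible by P because
   p and p' differ; by the descent, n deg P >= d. *)

(** The degree is ultrametric, and this replaces continued fractions: if a value of
    [a x^2 + b x y + c y^2] has smaller degree than [b], while [deg a + deg c < 2 deg b], its terms
    must cancel, and the cancellation shows which of [x], [y] a shear makes smaller. Along the cycle
    the condition holds because a multiple of [B^m], with [B = A] or [B = - A], dominates the middle
    coefficients; this takes [m > 1]. For [m = 1], monicity of [D] leaves only characteristics 3 and
    5, where [D] is a square plus a constant, apart from the excluded [D = A + 1]. The class group
    is a bare set here, so the pigeonhole principle stands in for Lagrange's theorem, and the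
    relation [p p' = (P)] provides the inverses of ideals. *)

Set Implicit Arguments.
Unset Strict Implicit.
Unset Printing Implicit Defensive.

Import Order.TTheory GRing.Theory Num.Theory.
Local Open Scope ring_scope.


(** * Reduced quadratic forms over F[T] *)

(* The instance paths inside [size] vary after rewriting, and block [lia]. *)
Ltac size_lia :=
  repeat match goal with H : context [size _] |- _ => revert H end;
  repeat match goal with
    |- context [@size _ (@polyseq _ ?p)] => move: (size p) => ?
  end; lia.

Ltac pos_lia :=
  repeat match goal with H : is_true (?p != 0) |- _ =>
    rewrite -size_poly_gt0 in H end; size_lia.

Section ReducedForms.
Variable F : fieldType.
Implicit Types a b c q x y : {poly F}.

Definition qform a b c x y := a * x ^+ 2 + b * x * y + c * y ^+ 2.

Lemma qformC a b c x y : qform a b c x y = qform c b a y x.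
Proof. by rewrite /qform; ring. Qed.

Lemma qform_shear a b c q x y :
  qform a b c x y = qform (a - b * q + c * q ^+ 2) (b - 2%:R * c * q) c x (y + q * x).
Proof. by rewrite /qform; ring. Qed.

(** The value is [y (b x + c y) + a x^2]. Without cancellation in [b x + c y], the first term has
    the degree of [c y^2], at least that of [b x y], and exceeds [a x^2] since
    [deg a + deg c < 2 deg b]; the value would then be no smaller than [b]. *)
Lemma qform_cancel a b c x y : a != 0 -> b != 0 -> x != 0 -> y != 0 ->
    (size a + size c < 2 * size b)%N -> (size (qform a b c x y) < size b)%N ->
    (size (b * x)%R <= size (c * y)%R)%N ->
  (size (b * x + c * y)%R < size (c * y)%R)%N.
Proof.
move=> a0 b0 x0 y0 hac hN hle; rewrite ltnNge; apply/negP => hge.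
have c0 : c != 0.
  apply: contraTneq hle => ->; rewrite mul0r size_poly0 leqn0 size_poly_eq0.
  by rewrite mulf_neq0.
have hle' : (size b + size x <= size c + size y)%N.
  by move: hle; rewrite !size_mul //; pos_lia.
have hsz : size (b * x + c * y) = size (c * y).
  apply/eqP; rewrite eqn_leq hge andbT.
  by apply: leq_trans (size_polyD _ _) _; rewrite geq_max hle leqnn.
have s0 : b * x + c * y != 0.
  by rewrite -size_poly_eq0 hsz size_poly_eq0 mulf_neq0.
have eN : qform a b c x y = y * (b * x + c * y) + a * x ^+ 2 by rewrite /qform; ring.
move: hN hle; rewrite eN expr2 size_polyDl; rewrite !size_mul ?mulf_neq0 ?hsz ?size_mul //.
  by pos_lia.
pos_lia.
Qed.

(** If both alternatives fail, [b x y] strictly dominates the two other terms, and the value has at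
    least the degree of [b]. *)
Lemma qform_dichotomy a b c x y : a != 0 -> b != 0 -> c != 0 -> x != 0 -> y != 0 ->
    (size (qform a b c x y) < size b)%N ->
  (size (b * x)%R <= size (c * y)%R)%N \/ (size (b * y)%R <= size (a * x)%R)%N.
Proof.
move=> a0 b0 c0 x0 y0 hN; case: leqP => [|h1]; first by left.
right; rewrite leqNgt; apply/negP => h2.
have eN : qform a b c x y = b * y * x + (a * x * x + c * y * y).
  by rewrite /qform; ring.
suff: (size b <= size (qform a b c x y))%N by size_lia.
rewrite eN size_polyDl.
  by rewrite !size_mul ?mulf_neq0 //; pos_lia.
apply: leq_ltn_trans (size_polyD _ _) _; rewrite gtn_max.
move: h1 h2; rewrite !size_mul ?mulf_neq0 //.
by pos_lia.
Qed.

(** Both terms of [c (y + q x) = (b x + c y) - (b - c q) x] are smaller than [c y]. The remainder is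
    compared with [b] and not with [c], because the remainders [v (B + 1)] met below can be as large
    as [c]. *)
Lemma shear_size b c q x y : x != 0 ->
    (size (b - c * q)%R < size b)%N ->
    (size (b * x)%R <= size (c * y)%R)%N -> (size (b * x + c * y)%R < size (c * y)%R)%N ->
  (size (y + q * x)%R < size y)%N.
Proof.
move=> x0 hq hle hlt.
have b0 : b != 0 by rewrite -size_poly_gt0; lia.
have c0 : c != 0.
  by apply: contraTneq hlt => ->; rewrite mul0r size_poly0; size_lia.
have y0 : y != 0.
  by apply: contraTneq hlt => ->; rewrite mulr0 size_poly0; size_lia.
have [->|z0] := eqVneq (y + q * x) 0; first by rewrite size_poly0 size_poly_gt0.
have: (size (c * (y + q * x))%R < size (c * y)%R)%N.
  have -> : c * (y + q * x) = (b * x + c * y) - (b - c * q) * x by ring.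
  apply: leq_ltn_trans (size_polyD _ _) _; rewrite gtn_max hlt size_polyN /=.
  apply: leq_trans hle; apply: leq_ltn_trans (size_polyMleq _ _) _.
  by rewrite size_mul //; pos_lia.
rewrite !size_mul //; pos_lia.
Qed.

(** The descent runs on any such set of forms: on [long_forms], and on forms with constant outer
    coefficients when [D] is a square plus a constant. *)
Variables (d : nat) (FF : {poly F} -> {poly F} -> {poly F} -> Prop).
Hypothesis FF_size : forall a b c, FF a b c ->
  [/\ a != 0, c != 0, (size a + size c < 2 * size b)%N & (d < size b)%N].
Hypothesis FF_gap : forall a b c, FF a b c ->
  (size a = 1%N \/ (d < size a)%N) /\ (size c = 1%N \/ (d < size c)%N).
(* The coefficient that is kept, [c] here and [a] in [FF_right], belongs to the
   variable that shrinks. *)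
Hypothesis FF_left : forall a b c, FF a b c ->
  exists2 q, (size (b - c * q)%R < size b)%N &
    FF (a - b * q + c * q ^+ 2) (b - 2%:R * c * q) c.
Hypothesis FF_right : forall a b c, FF a b c ->
  exists2 q, (size (b - a * q)%R < size b)%N &
    FF a (b - 2%:R * a * q) (c - b * q + a * q ^+ 2).

Lemma small_value_axis a x : a != 0 -> x != 0 -> size a = 1%N \/ (d < size a)%N ->
  (size (a * x ^+ 2)%R <= d)%N -> a * x ^+ 2 %= x ^+ 2.
Proof.
move=> a0 x0 [a1 _ | dlt]; last first.
  rewrite expr2 !size_mul ?mulf_neq0 //.
  by pos_lia.
rewrite -{2}[x ^+ 2]mul1r; apply: eqp_mulr.
by rewrite -size_poly_eq1 a1.
Qed.

(** Shears are unimodular, so they preserve the common divisors of [x] and [y], and each one shrinks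
    a variable. Once a variable vanishes, the value is an outer coefficient times a square, and the
    gap forces that coefficient to be constant. *)
Lemma small_value a b c x y : FF a b c -> qform a b c x y != 0 ->
    (size (qform a b c x y) <= d)%N ->
  exists g, [/\ g %| x, g %| y & qform a b c x y %= g ^+ 2].
Proof.
have [n] := ubnP (size x + size y)%N; elim: n a b c x y => // n IHn a b c x y.
move=> hn hF N0 Nd.
have [a0 c0 hac hb] := FF_size hF; have [ga gc] := FF_gap hF.
have b0 : b != 0 by rewrite -size_poly_gt0; lia.
have [y0|y0] := eqVneq y 0.
  have eN : qform a b c x y = a * x ^+ 2 by rewrite /qform y0; ring.
  rewrite eN in N0 Nd *; exists x; split; rewrite ?y0 ?dvdp0 //.
  apply: small_value_axis => //.
  by apply: contraNneq N0 => ->; rewrite expr2 !mulr0.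
have [x0|x0] := eqVneq x 0.
  have eN : qform a b c x y = c * y ^+ 2 by rewrite /qform x0; ring.
  rewrite eN in N0 Nd *; exists y; split; rewrite ?x0 ?dvdp0 //.
  exact: small_value_axis.
have hN : (size (qform a b c x y) < size b)%N by size_lia.
case: (qform_dichotomy a0 b0 c0 x0 y0 hN) => hle.
  have hlt := qform_cancel a0 b0 x0 y0 hac hN hle.
  have [q hq hF'] := FF_left hF.
  have hy := shear_size x0 hq hle hlt.
  rewrite (qform_shear a b c q) in N0 Nd *.
  have [|g [gx gy gN]] := IHn _ _ _ _ _ _ hF' N0 Nd; first by size_lia.
  exists g; split => //.
  by rewrite -(dvdp_addl _ (dvdp_mull q gx)).
rewrite qformC in N0 Nd hN *; rewrite addnC in hac.
have hlt := qform_cancel c0 b0 y0 x0 hac hN hle.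
have [q hq hF'] := FF_right hF.
have hx := shear_size y0 hq hle hlt.
rewrite (qform_shear _ _ _ q) qformC in N0 Nd *.
have [|g [gx gy gN]] := IHn _ _ _ _ _ _ hF' N0 Nd; first by size_lia.
exists g; split => //.
by rewrite -(dvdp_addl _ (dvdp_mull q gy)).
Qed.

End ReducedForms.

Lemma size_unit_mul (F : fieldType) (u p : {poly F}) :
  u \is a GRing.unit -> size (u * p) = size p.
Proof.
have [->|p0] := eqVneq p 0; first by rewrite mulr0.
rewrite poly_unitE => /andP[/eqP u1 _].
have u0 : u != 0 by rewrite -size_poly_gt0 u1.
by rewrite size_mul // u1.
Qed.

Lemma size_polyD_lt (F : fieldType) (p q : {poly F}) n :
  (size p < n)%N -> (size q < n)%N -> (size (p + q)%R < n)%N.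
Proof. by move=> hp hq; apply: leq_ltn_trans (size_polyD _ _) _; rewrite gtn_max hp. Qed.

Lemma size_expS (F : fieldType) (p : {poly F}) d n :
  size p = d.+1 -> size (p ^+ n) = (n * d).+1.
Proof.
move=> hp; have p0 : p != 0 by rewrite -size_poly_gt0 hp.
elim: n => [|n IHn]; first by rewrite expr0 size_poly1.
rewrite exprS size_mul ?expf_neq0 // hp IHn; lia.
Qed.

(** * The explicit cycle of reduced forms *)

Section Families.
Variables (F : fieldType) (B k h : {poly F}) (d m : nat).
Hypotheses (hB : size B = d.+1) (d0 : (0 < d)%N) (m2 : (1 < m)%N).
Hypotheses (hk : k * k = 1) (hh : 2%:R * h = 1).

(** The identity [t^2 - 8 k B^m = s^2 + 8 k B^(m+1)] gives the forms with middle coefficient [t] and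
    those with [s] the same discriminant. *)
Let t := 2%:R * k * B ^+ m + B + 1.
Let s := B + 1 - 2%:R * k * B ^+ m.

(* In all four cases [D = (k B^m + h (B - 1))^2 + B] with [B = A] or [B = - A],
   [k = 1] or [k = -1] and [h = 1/2], so [4 D = t^2 - 8 k B^m]. The forms below
   have discriminant [4 D]; the signs [u] and [v] make the set stable under
   reduction. *)
Definition long_forms (a b c : {poly F}) : Prop :=
  exists u v : {poly F}, [/\ u * u = 1, v * v = 1 &
    (exists i j, [/\ (i + j)%N = m, a = u * B ^+ i, b = v * t & c = 2%:R * u * k * B ^+ j]) \/
    (exists i j, [/\ (i + j).+1 = m, a = - u * B ^+ i.+1, b = v * s & c = 2%:R * u * k * B ^+ j.+1])].

Let unit_sq (u : {poly F}) : u * u = 1 -> u \is a GRing.unit.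
Proof. by move=> hu; apply/unitrPr; exists u. Qed.

Let unit2 : (2%:R : {poly F}) \is a GRing.unit.
Proof. by apply/unitrPr; exists h. Qed.

Let szB n : size (B ^+ n) = (n * d).+1.
Proof. exact: size_expS. Qed.

Let szB1 : (size (B + 1)%R < (m * d).+1)%N.
Proof. by apply: size_polyD_lt; rewrite ?size_poly1 ?hB; nia. Qed.

Let szt : size t = (m * d).+1.
Proof.
rewrite /t -addrA size_polyDl -mulrA !size_unit_mul ?szB //; exact: unit_sq.
Qed.

Let szs : size s = (m * d).+1.
Proof.
rewrite /s addrC size_polyDl size_polyN -mulrA !size_unit_mul ?szB //; exact: unit_sq.
Qed.

Lemma long_forms_size a b c : long_forms a b c ->
  [/\ a != 0, c != 0, (size a + size c < 2 * size b)%N & (d < size b)%N].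
Proof.
move=> [u [v [hu hv [[i [j [ij ea eb ec]]] | [i [j [ij ea eb ec]]]]]]]; subst a b c;
  rewrite -!size_poly_gt0 ?mulNr ?size_polyN -?mulrA !size_unit_mul ?szB ?szt ?szs //;
  try exact: unit_sq.
all: by split=> //; nia.
Qed.

Lemma long_forms_gap a b c : long_forms a b c ->
  (size a = 1%N \/ (d < size a)%N) /\ (size c = 1%N \/ (d < size c)%N).
Proof.
have gap n : (n * d).+1 = 1%N \/ (d < (n * d).+1)%N by case: n => [|n]; [left|right; nia].
by move=> [u [v [hu hv [[i [j [ij ea eb ec]]] | [i [j [ij ea eb ec]]]]]]]; subst a b c;
  rewrite ?mulNr ?size_polyN -?mulrA !size_unit_mul ?szB ?szt ?szs //;
  try exact: unit_sq; split; apply: gap.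
Qed.

(** Unless [c] is constant, [q] removes the [B^m] term of [b] and leaves [v (B + 1)]. With [c] kept,
    the shear exchanges outer exponents [(i, j+1)] with middle [t] for [(i+1, j+1)] with middle [s],
    and back. *)
Lemma long_forms_left a b c : long_forms a b c ->
  exists2 q, (size (b - c * q)%R < size b)%N &
    long_forms (a - b * q + c * q ^+ 2) (b - 2%:R * c * q) c.
Proof.
move=> [u [v [hu hv [[i [j [ij ea eb ec]]] | [i [j [ij ea eb ec]]]]]]]; subst a b c.
(* For [c] constant, [q = b / c] exactly and the shear only changes the sign of [b]: this is an end
   of the chain, where it is reflected. *)
- case: j ij => [|j] ij.
    have [w tw] : exists w, t = 2%:R * w by exists (h * t); rewrite mulrA hh mul1r.
    exists (u * v * k * w).
      have -> : v * t - 2%:R * u * k * B ^+ 0 * (u * v * k * w) = 0.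
        rewrite expr0 tw; ring: hu hk.
      by rewrite size_poly0 size_unit_mul ?szt //; apply: unit_sq.
    exists u, (- v); split; rewrite ?mulrNN //; left; exists i, 0%N; split => //.
      rewrite expr0 tw; ring: hu hk hv.
    rewrite expr0 tw; ring: hu hk hv.
  exists (u * v * B ^+ i).
    have -> : v * t - 2%:R * u * k * B ^+ j.+1 * (u * v * B ^+ i) = v * (B + 1).
      rewrite /t -ij exprD; ring: hu.
    by rewrite !size_unit_mul ?szt //; apply: unit_sq.
  exists u, v; split => //; right; exists i, j; split; first by lia.
  + by rewrite /t -ij exprD (exprS _ i) exprS; ring: hu hv.
  + by rewrite /t /s -ij exprD; ring: hu hv.
  + by [].
- exists (- u * v * B ^+ i).
    have -> : v * s - 2%:R * u * k * B ^+ j.+1 * (- u * v * B ^+ i) = v * (B + 1).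
      rewrite /s -ij -addnS exprD; ring: hu.
    by rewrite !size_unit_mul ?szs //; apply: unit_sq.
  exists u, v; split => //; left; exists i, j.+1; split; first by lia.
  + by rewrite /s -ij -addnS exprD (exprS _ i) exprS; ring: hu hv.
  + by rewrite /t /s -ij -addnS exprD; ring: hu hv.
  + by [].
Qed.

(** With [a] kept, exponents [(i+1, j+1)] with [s] correspond to [(i+1, j)] with [t]. Alternating
    with the left shears, this walks the whole chain up to its other end, where [a] is constant. *)
Lemma long_forms_right a b c : long_forms a b c ->
  exists2 q, (size (b - a * q)%R < size b)%N &
    long_forms a (b - 2%:R * a * q) (c - b * q + a * q ^+ 2).
Proof.
move=> [u [v [hu hv [[i [j [ij ea eb ec]]] | [i [j [ij ea eb ec]]]]]]]; subst a b c.
- case: i ij => [|i] ij.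
    exists (u * v * t).
      have -> : v * t - u * B ^+ 0 * (u * v * t) = 0.
        rewrite expr0 /t; ring: hu.
      by rewrite size_poly0 size_unit_mul ?szt //; apply: unit_sq.
    exists u, (- v); split; rewrite ?mulrNN //; left; exists 0%N, j; split => //.
      rewrite expr0; ring: hu hv.
    rewrite expr0; ring: hu hv.
  exists (2%:R * u * v * k * B ^+ j).
    have -> : v * t - u * B ^+ i.+1 * (2%:R * u * v * k * B ^+ j) = v * (B + 1).
      rewrite /t -ij exprD; ring: hu.
    by rewrite !size_unit_mul ?szt //; apply: unit_sq.
  exists (- u), v; split; rewrite ?mulrNN //; right; exists i, j; split; first by lia.
  + by rewrite opprK.
  + by rewrite /t /s -ij exprD; ring: hu hv.
  + by rewrite /t -ij exprD !exprS; ring: hu hv hk.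
- exists (2%:R * u * v * k * B ^+ j).
    have -> : v * s - (- u * B ^+ i.+1) * (2%:R * u * v * k * B ^+ j) = v * (B + 1).
      rewrite /s -ij -addSn exprD; ring: hu.
    by rewrite !size_unit_mul ?szs //; apply: unit_sq.
  exists (- u), v; split; rewrite ?mulrNN //; left; exists i.+1, j; split; first by lia.
  + by [].
  + by rewrite /t /s -ij -addSn exprD; ring: hu hv.
  + by rewrite /s -ij -addSn exprD !exprS; ring: hu hv hk.
Qed.
End Families.

(** * Small norms *)

Definition norm_gap (F : fieldType) (d : nat) (D : {poly F}) : Prop :=
  forall x y : {poly F}, x ^+ 2 - D * y ^+ 2 != 0 ->
    (size (x ^+ 2 - D * y ^+ 2)%R <= d)%N ->
  exists g, [/\ g %| x, g %| y & x ^+ 2 - D * y ^+ 2 %= g ^+ 2].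

Section NormGap.
Variable F : fieldType.
Implicit Types A B D S a c e h k : {poly F}.

(** Replacing [x] by [x - e y], which keeps the common divisors, turns the norm form into
    [(1, 2 e, e^2 - D)]. *)
Lemma norm_gap_form d (FF : {poly F} -> {poly F} -> {poly F} -> Prop) D e c :
  (forall a b c, FF a b c ->
    [/\ a != 0, c != 0, (size a + size c < 2 * size b)%N & (d < size b)%N]) ->
  (forall a b c, FF a b c ->
    (size a = 1%N \/ (d < size a)%N) /\ (size c = 1%N \/ (d < size c)%N)) ->
  (forall a b c, FF a b c ->
    exists2 q, (size (b - c * q)%R < size b)%N &
      FF (a - b * q + c * q ^+ 2) (b - 2%:R * c * q) c) ->
  (forall a b c, FF a b c ->
    exists2 q, (size (b - a * q)%R < size b)%N &
      FF a (b - 2%:R * a * q) (c - b * q + a * q ^+ 2)) ->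
  FF 1 (2%:R * e) c -> D = e ^+ 2 - c -> norm_gap d D.
Proof.
move=> Fsize Fgap Fleft Fright Fe eD x y.
have -> : x ^+ 2 - D * y ^+ 2 = qform 1 (2%:R * e) c (x - e * y) y.
  by rewrite eD /qform; ring.
move=> N0 Nd; have [g [gx gy gN]] := small_value Fsize Fgap Fleft Fright Fe N0 Nd.
exists g; split=> //.
by rewrite -(dvdp_addl _ (dvdp_mull (- e) gy)) mulNr.
Qed.

Lemma norm_gap_long d m B k h D :
  size B = d.+1 -> (0 < d)%N -> (1 < m)%N -> k * k = 1 -> 2%:R * h = 1 ->
  D = (k * B ^+ m + h * (B - 1)) ^+ 2 + B -> norm_gap d D.
Proof.
move=> hB d0 m2 hk hh eD.
apply: (norm_gap_form (FF := long_forms B k m) (e := k * B ^+ m + h * (B + 1))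
  (c := 2%:R * k * B ^+ m)).
- exact: (long_forms_size hB d0 m2 hk hh).
- exact: (long_forms_gap hB d0 m2 hk hh).
- exact: (long_forms_left hB d0 m2 hk hh).
- exact: (long_forms_right hB d0 m2 hk hh).
- exists 1, 1; rewrite !mulr1; split=> //; left; exists 0%N, m; split=> //.
  + by rewrite expr0 mulr1.
  + by rewrite mul1r mulrDr !mulrA hh mul1r; ring.
- have hh' : h * 2%:R = 1 by rewrite mulrC.
  rewrite eD.
  have -> : (k * B ^+ m + h * (B + 1)) ^+ 2 - 2%:R * k * B ^+ m =
     (k * B ^+ m + h * (B - 1)) ^+ 2 + B + (2%:R * h - 1) * (2%:R * k * B ^+ m + (2%:R * h + 1) * B).
    ring.
  by rewrite hh subrr mul0r addr0.
Qed.

(** With constant outer coefficients every division is exact and a shear only changes the sign of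
    [b]: the cycle shrinks to [(1, 2 S, - c)] and its reflection. *)
Lemma norm_gap_short d S c D : (0 < d)%N -> (2%:R : F) != 0 ->
  size S = d.+1 -> size c = 1%N -> D = S ^+ 2 + c -> norm_gap d D.
Proof.
move=> d0 two hS hc eD.
have u2 : (2%:R : {poly F}) \is a GRing.unit.
  by rewrite poly_unitE -polyC_natr size_polyC two coefC eqxx unitfE two.
pose FF (a b c : {poly F}) := [/\ size a = 1%N, size c = 1%N & (d < size b)%N].
have inv1 (p : {poly F}) : size p = 1%N -> exists p', p * p' = 1.
  move=> /eqP /size_poly1P [a a0 ->].
  by exists a^-1%:P; rewrite -polyCM divff.
apply: (norm_gap_form (FF := FF) (e := S) (c := - c)).
- move=> a b c' [a1 c1 hb]; rewrite -!size_poly_gt0 a1 c1; split=> //; lia.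
- by move=> a b c' [a1 c1 hb]; split; left.
- move=> a b c' [a1 c1 hb]; have [p hp] := inv1 _ c1; exists (p * b).
    by rewrite mulrA hp mul1r subrr size_poly0; lia.
  have -> : b - 2%:R * c' * (p * b) = - b by ring: hp.
  have -> : a - b * (p * b) + c' * (p * b) ^+ 2 = a by ring: hp.
  by rewrite /FF size_polyN.
- move=> a b c' [a1 c1 hb]; have [p hp] := inv1 _ a1; exists (p * b).
    by rewrite mulrA hp mul1r subrr size_poly0; lia.
  have -> : b - 2%:R * a * (p * b) = - b by ring: hp.
  have -> : c' - b * (p * b) + a * (p * b) ^+ 2 = c' by ring: hp.
  by rewrite /FF size_polyN.
- by split; rewrite ?size_poly1 ?size_polyN // size_unit_mul ?hS.
- by rewrite opprK.
Qed.

(* For [m = 1] the leading coefficient of [D] is [(k + 1/2)^2]; it is [1] only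
   in characteristic 5 (for [k = 1]) or 3 (for [k = -1]). *)
Lemma norm_gap_linear d B D (h : F) (k : F) : (0 < d)%N -> 2%:R * h = 1 ->
  size B = d.+1 -> lead_coef B ^+ 2 = 1 -> k ^+ 2 = 1 -> D \is monic ->
  D = (k%:P * B + h%:P * (B - 1)) ^+ 2 + B ->
  (k = 1 -> (3%:R : F) != 0) -> norm_gap d D.
Proof.
move=> d0 hh hB lB k2 mD eD h3.
have two : (2%:R : F) != 0 by apply: contra_eq_neq hh => ->; rewrite mul0r eq_sym oner_eq0.
have h0 : h != 0 by apply: contra_eq_neq hh => ->; rewrite mulr0 eq_sym oner_eq0.
have szl (c : F) (p : {poly F}) : (size (c%:P * p)%R <= size p)%N.
  by rewrite mul_polyC; exact: size_scale_leq.
have lead (c e : F) : c != 0 -> D = c%:P * B ^+ 2 + (e%:P * B + (h ^+ 2)%:P) -> c = 1.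
  move=> c0 eD'; have := mD; rewrite monicE eD' lead_coefDl.
    by rewrite lead_coefM lead_coefC lead_coef_exp lB mulr1 => /eqP.
  rewrite (mul_polyC c) size_scale // (size_expS _ hB).
  apply: size_polyD_lt; first by have := szl e B; rewrite hB; lia.
  by rewrite (leq_ltn_trans (size_polyC_leq1 _)) //; lia.
have hhP : 2%:R * h%:P = 1 :> {poly F} by rewrite -polyC_natr -polyCM hh.
have : (k == 1) || (k == -1) by rewrite -eqf_sqr k2 expr1n.
case/orP => /eqP ek; rewrite {}ek ?polyCN polyC1 in eD h3.
(* This leading coefficient vanishes only in characteristic 3, which [h3] rules out for [k = 1]. *)
- have c0 : (9%:R * h ^+ 2 : F) != 0.
    by rewrite mulf_neq0 ?expf_neq0 // (natrM _ 3 3) mulf_neq0 ?h3.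
  have eD' : D = (9%:R * h ^+ 2)%:P * B ^+ 2 + ((- h)%:P * B + (h ^+ 2)%:P).
    rewrite eD polyCM polyC_exp polyCN polyC_natr.
    have -> : (1 * B + h%:P * (B - 1)) ^+ 2 + B =
      9%:R * h%:P ^+ 2 * B ^+ 2 + (- h%:P * B + h%:P ^+ 2) +
      (1 - 2%:R * h%:P) * ((1 + 4%:R * h%:P) * B ^+ 2 + (1 + h%:P) * B) by ring.
    by rewrite hhP subrr mul0r addr0.
  have c1 := lead _ _ c0 eD'.
  have five : (5%:R : F) = 0.
    apply: (mulIf (expf_neq0 2 h0)); rewrite mul0r.
    have -> : 5%:R * h ^+ 2 = 9%:R * h ^+ 2 - (2%:R * h) ^+ 2 by ring.
    by rewrite c1 hh expr1n subrr.
  have hm2 : h = - 2%:R.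
    have -> : h = - 2%:R * (2%:R * h) + 5%:R * h by ring.
    by rewrite hh five mul0r addr0 mulr1.
  (* In characteristic 5, [D = B^2 + 2 B + 4 = (B + 1)^2 + 3]. *)
  apply: (norm_gap_short (S := B + 1) (c := 3%:R) d0 two).
  + by rewrite size_polyDl ?hB ?size_poly1.
  + by rewrite -polyC_natr size_polyC h3.
  + rewrite eD' c1 hm2 opprK polyC_exp polyCN polyC_natr polyC1; ring.
- have c0 : h ^+ 2 != 0 by rewrite expf_neq0.
  have eD' : D = (h ^+ 2)%:P * B ^+ 2 + ((3%:R * h)%:P * B + (h ^+ 2)%:P).
    rewrite eD polyC_exp polyCM polyC_natr.
    have -> : (- 1 * B + h%:P * (B - 1)) ^+ 2 + B =
      h%:P ^+ 2 * B ^+ 2 + (3%:R * h%:P * B + h%:P ^+ 2) +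
      (1 - 2%:R * h%:P) * (B ^+ 2 + (1 + h%:P) * B) by ring.
    by rewrite hhP subrr mul0r addr0.
  have c1 := lead _ _ c0 eD'.
  have three : (3%:R : F) = 0.
    have : 3%:R * h ^+ 2 = (2%:R * h) ^+ 2 - h ^+ 2 by ring.
    by rewrite c1 hh mulr1 expr1n subrr.
  apply: (norm_gap_short (S := B) (c := 1) d0 two); rewrite ?size_poly1 //.
  by rewrite eD' c1 three mul0r polyC0 mul0r add0r polyC1 mul1r.
Qed.
End NormGap.

(** Since [a = (A - 1) / 2] and [a + 1 = (A + 1) / 2], cases (1) and (2) have the common shape with
    [B = A], and cases (3) and (4) with [B = - A], where [k] also absorbs the sign [(-1)^m]. *)
Lemma norm_gap_cases (F : fieldType) (a A D : {poly F}) (m : nat) :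
  (2%:R : F) != 0 -> (0 < deg a)%N -> A = 2%:R * a + 1 -> A \is monic ->
  (0 < m)%N ->
  [\/ D = (A ^+ m + a) ^+ 2 + A, D = (A ^+ m - a) ^+ 2 + A,
      D = (A ^+ m + a + 1) ^+ 2 - A | D = (A ^+ m - a - 1) ^+ 2 - A] ->
  ((3%:R : F) = 0 -> m = 1%N -> D <> (A ^+ m + a) ^+ 2 + A) ->
  D \is monic -> (0 < deg A)%N /\ norm_gap (deg A) D.
Proof.
move=> two ha hA mA hm hD hexc mD.
pose h : F := 2%:R^-1; have hh : 2%:R * h = 1 by rewrite divff.
have hhP : 2%:R * h%:P = 1 :> {poly F} by rewrite -polyC_natr -polyCM hh.
have u2 : (2%:R : {poly F}) \is a GRing.unit by apply/unitrPr; exists h%:P.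
have szA : size A = (deg A).+1.
  by rewrite /deg prednK // size_poly_gt0 monic_neq0.
have dA : (0 < deg A)%N.
  rewrite /deg hA size_polyDl size_unit_mul // size_poly1.
  by move: ha; rewrite /deg; lia.
split=> //.
have ea : a = h%:P * (A - 1) by rewrite hA addrK mulrA [h%:P * _]mulrC hhP mul1r.
suff [B [k [k2 hB lB eD h3]]] : exists (B : {poly F}) (k : F),
   [/\ k ^+ 2 = 1, size B = (deg A).+1, lead_coef B ^+ 2 = 1,
     D = (k%:P * B ^+ m + h%:P * (B - 1)) ^+ 2 + B
   & m = 1%N -> k = 1 -> (3%:R : F) != 0].
  have [m1|m1] := eqVneq m 1%N.
    by rewrite m1 expr1 in eD; apply: (norm_gap_linear dA hh hB lB k2 mD eD (h3 m1)).
  apply: (norm_gap_long (m := m) (k := k%:P) hB dA _ _ hhP eD); first by lia.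
  by rewrite -polyCM -expr2 k2.
have lA : lead_coef A = 1 by apply/eqP; rewrite -monicE.
have sN : size (- A) = (deg A).+1 by rewrite size_polyN.
have lN : lead_coef (- A) ^+ 2 = 1 by rewrite lead_coefN lA sqrrN expr1n.
have lA2 : lead_coef A ^+ 2 = 1 by rewrite lA expr1n.
have one_neg : (1 : F) != -1.
  by rewrite -subr_eq0 opprK -[1 + 1]/(2%:R : F).
have sgn2 : ((-1 : F) ^+ m) ^+ 2 = 1 by rewrite exprAC sqrrN !expr1n.
case: hD => eD.
- exists A, 1; split; rewrite ?expr1n //.
    by rewrite eD polyC1 mul1r -ea.
  by move=> m1 _; apply/negP => /eqP h3; apply: (hexc h3 m1).
- exists A, (-1); split; rewrite ?sqrrN ?expr1n //.
    by rewrite eD polyCN polyC1 ea; ring.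
  by move=> _ /esym/eqP; rewrite (negPf one_neg).
- exists (- A), (- (-1) ^+ m); split; rewrite ?sqrrN ?sgn2 //.
    have e : (- (-1) ^+ m)%:P * (- A) ^+ m = - A ^+ m.
      rewrite -(mulN1r A) exprMn polyCN polyC_exp polyCN polyC1 mulrA mulNr -exprMn.
      by rewrite mulrNN mulr1 expr1n mulN1r.
    rewrite e eD ea.
    have -> : (- A ^+ m + h%:P * (- A - 1)) ^+ 2 + - A =
      (A ^+ m + h%:P * (A - 1) + (2%:R * h%:P)) ^+ 2 - A by ring.
    by rewrite hhP.
  (* For [m = 1] in characteristic 3, case (3) reads [D = 1 - A], which is not monic. *)
  move=> m1 _; apply/negP => /eqP h3.
  have hm1 : h = -1.
    have -> : h = 3%:R * h - 2%:R * h by ring.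
    by rewrite h3 hh mul0r sub0r.
  have : D = - A + 1.
    rewrite eD m1 ea hm1 polyCN polyC1 expr1.
    have -> : (A + - 1 * (A - 1) + 1) ^+ 2 - A = 3%:R + (- A + 1) by ring.
    by rewrite -polyC_natr h3 polyC0 add0r.
  move=> eD'; have := mD; rewrite monicE eD' lead_coefDl.
    by rewrite lead_coefN lA eq_sym (negPf one_neg).
  by rewrite size_poly1 sN.
- exists (- A), ((-1) ^+ m); split; rewrite ?sgn2 //.
    have e : ((-1) ^+ m)%:P * (- A) ^+ m = A ^+ m.
      rewrite -(mulN1r A) exprMn polyC_exp polyCN polyC1 mulrA -exprMn.
      by rewrite mulrNN mulr1 expr1n mul1r.
    rewrite e eD ea.
    have -> : (A ^+ m + h%:P * (- A - 1)) ^+ 2 + - A =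
      (A ^+ m - h%:P * (A - 1) - (2%:R * h%:P)) ^+ 2 - A by ring.
    by rewrite hhP.
  by move=> ->; rewrite expr1 => /esym/eqP; rewrite (negPf one_neg).
Qed.

(** * Coordinates in K *)

HB.instance Definition _ (F : fieldType) (K : fieldExtType {fraction {poly F}}) :=
  GRing.RMorphism.copy (@polyK F K) (in_alg K \o @tofrac _).

Section Coordinates.
Variables (F : fieldType) (K : fieldExtType {fraction {poly F}}).
Implicit Types f g d p : {poly F}.
Local Notation i_ := (@polyK F K).

Lemma polyK_eq0 f : (i_ f == 0) = (f == 0).
Proof. by rewrite /polyK scaler_eq0 oner_eq0 orbF tofrac_eq0. Qed.

Lemma polyK_inj : injective i_.
Proof.
move=> f g /eqP; rewrite -subr_eq0 -rmorphB polyK_eq0 subr_eq0; exact: eqP.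
Qed.

Lemma tofrac_repr (u : {fraction {poly F}}) :
  exists f d, d != 0 /\ tofrac d * u = tofrac f.
Proof.
elim/quotW: u => r; exists \n_r, \d_r; split; first exact: denom_ratioP.
unlock tofrac; rewrite -[LHS]FracField.pi_mul; apply/eqmodP.
rewrite /= FracField.equivfE /FracField.mulf !numden_Ratio ?oner_eq0 ?mulf_neq0 ?mul1r ?denom_ratioP //.
  by rewrite mulr1 mulrC.
all: exact: oner_neq0.
Qed.

(** F[T] is integrally closed, by the rational root argument: in lowest terms [f' / d'], the monic
    equation cleared of denominators shows that [d'] divides a power of [f']. *)
Lemma integral_fraction f d : d != 0 -> integralOver i_ (i_ f / i_ d) -> d %| f.
Proof.
move=> d0 [p mp rp].
pose g := gcdp f d.
have g0 : g != 0 by rewrite gcdp_eq0 negb_and d0 orbT.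
have [f' [d' [ef ed cop]]] : exists f' d', [/\ f = f' * g, d = d' * g & coprimep d' f'].
  exists (f %/ g), (d %/ g); rewrite !divpK ?dvdp_gcdl ?dvdp_gcdr //.
  by rewrite coprimep_sym coprimep_div_gcd ?d0 ?orbT.
have d'0 : d' != 0 by apply: contraNneq d0 => e; rewrite ed e mul0r.
suff dvd : d' %| f' ^+ (size p).-1.
  have /coprimepP/(_ d' (dvdpp _) dvd) : coprimep d' (f' ^+ (size p).-1) by exact: coprimep_expr.
  move=> d1; rewrite ef ed dvdp_mul2r //.
  by rewrite (eqp_dvdl _ d1) dvd1p.
have sp : (size p).-1.+1 = size p by rewrite prednK // size_poly_gt0 monic_neq0.
have pn : p`_(size p).-1 = 1 by move: mp; rewrite monicE => /eqP.
set n := (size p).-1 in sp pn *.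
have : \sum_(i < n.+1) p`_i * f' ^+ i * d' ^+ (n - i) = 0.
  apply: polyK_inj; rewrite rmorph0 rmorph_sum /=.
  have ex : i_ f / i_ d = i_ f' / i_ d'.
    by rewrite ef ed !rmorphM /= -mulf_div divff ?polyK_eq0 // mulr1.
  move: rp; rewrite ex rootE horner_coef (size_map_inj_poly polyK_inj) ?rmorph0 // -sp.
  move=> /eqP/(congr1 (fun z => i_ d' ^+ n * z)); rewrite mulr0 mulr_sumr => E.
  apply: etrans E.
  apply: eq_bigr => i _; rewrite coef_map !rmorphM !rmorphXn /= expr_div_n.
  have -> : i_ d' ^+ n = i_ d' ^+ (n - i) * i_ d' ^+ i.
    by rewrite -exprD subnK // -ltnS.
  have : i_ d' ^+ i != 0 by rewrite expf_neq0 ?polyK_eq0.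
  move: (i_ d' ^+ i) => e e0; field; exact: e0.
rewrite big_ord_recr /= subnn expr0 mulr1.
rewrite pn mul1r => /eqP; rewrite addrC addr_eq0 => /eqP ->.
rewrite dvdpNr; apply: (big_ind (fun q => d' %| q)); first exact: dvdp0.
  by move=> x y; apply: dvdp_add.
move=> i _; apply: dvdp_mull; rewrite -(subnSK (ltn_ord i)) exprS; exact: dvdp_mulIl.
Qed.

Variables (D : {poly F}) (s : K).
Hypotheses (two : (2%:R : F) != 0) (hsqf : squarefree D).
Hypothesis hns : ~ exists Q : {poly F}, D = Q ^+ 2.
Hypothesis hs : generated_by_sqrt D s.

Definition elt (f g : {poly F}) : K := i_ f + i_ g * s.

Lemma elt_add f g f' g' : elt f g + elt f' g' = elt (f + f') (g + g').
Proof. by rewrite /elt !rmorphD /=; ring. Qed.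

Lemma elt_opp f g : - elt f g = elt (- f) (- g).
Proof. by rewrite /elt !rmorphN /=; ring. Qed.

Lemma elt_mul f g f' g' :
  elt f g * elt f' g' = elt (f * f' + D * g * g') (f * g' + g * f').
Proof.
rewrite /elt !rmorphD !rmorphM /=.
have [hs2 _] := hs; rewrite -hs2; ring.
Qed.

Lemma elt_poly f : elt f 0 = i_ f.
Proof. by rewrite /elt rmorph0 mul0r addr0. Qed.

Lemma elt_norm f g : elt f g * elt f (- g) = i_ (f ^+ 2 - D * g ^+ 2).
Proof. by rewrite elt_mul -elt_poly; congr elt; ring. Qed.

Lemma norm_eq0 f g : f ^+ 2 = D * g ^+ 2 -> f = 0 /\ g = 0.
Proof.
move=> e; have [g0|g0] := eqVneq g 0.
  split=> //; apply/eqP; rewrite -sqrf_eq0 e g0 expr2 !mulr0; exact: eqxx.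
case: hns; have : g ^+ 2 %| f ^+ 2 by rewrite e dvdp_mulIr.
rewrite dvdp_pexp2r // => /divpK eg; exists (f %/ g).
by apply: (mulIf (expf_neq0 2 g0)); rewrite -exprMn eg.
Qed.

Lemma elt_eq0 f g : elt f g = 0 -> f = 0 /\ g = 0.
Proof.
move=> e; apply: norm_eq0; apply/eqP; rewrite -subr_eq0 -polyK_eq0 -elt_norm e mul0r.
exact: eqxx.
Qed.

Lemma elt_inj f g f' g' : elt f g = elt f' g' -> f = f' /\ g = g'.
Proof.
move=> e; have : elt (f - f') (g - g') = 0 by rewrite -elt_add -elt_opp e subrr.
by move=> /elt_eq0 [/eqP + /eqP]; rewrite !subr_eq0 => /eqP -> /eqP ->.
Qed.

Lemma elt_denom x : exists f g d, d != 0 /\ i_ d * x = elt f g.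
Proof.
have : x \in <<1; s>>%VS by have [_ ->] := hs; rewrite memvf.
move=> /Fadjoin_polyP [p /polyOverP p1 ->].
elim/poly_ind: p p1 => [|p c IHp] p1.
  by exists 0, 0, 1; rewrite oner_neq0 horner0 mulr0 /elt rmorph0 mul0r addr0.
have [|f [g [d [d0 e]]]] := IHp.
  by move=> i; have := p1 i.+1; rewrite coefD coefMX coefC addr0.
have : c \in 1%VS by have := p1 0%N; rewrite coefD coefMX coefC add0r.
move=> /vlineP [u ->]; have [f' [d' [d'0 e']]] := tofrac_repr u.
have eu : i_ d' * u%:A = i_ f'.
  by rewrite /polyK -e' -scalerAr mulr1 scalerA mulrC.
exists (d' * D * g + d * f'), (d' * f), (d * d'); rewrite mulf_neq0 //; split=> //.
rewrite hornerMXaddC mulrDr mulrA !rmorphM /=.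
have -> : i_ d * i_ d' * p.[s] * s = i_ d' * (i_ d * p.[s]) * s by ring.
rewrite e -[i_ d * i_ d' * _]mulrA eu /elt !rmorphD !rmorphM /=.
have [hs2 _] := hs; rewrite -hs2; ring.
Qed.

(** No conjugation has to be constructed: the automorphism in [splits] will be taken for [sigma]. *)
Variable sigma : {rmorphism K -> K}.
Hypotheses (sigma_poly : forall f, sigma (i_ f) = i_ f) (sigma_s : sigma s = - s).

Lemma sigma_elt f g : sigma (elt f g) = elt f (- g).
Proof. by rewrite /elt rmorphD rmorphM /= !sigma_poly sigma_s rmorphN /=; ring. Qed.

Lemma integral_sigma x : integralOver i_ x -> integralOver i_ (sigma x).
Proof.
move=> /(integral_rmorph sigma) [p mp rp]; exists p => //.
by rewrite (eq_map_poly (g := sigma \o i_)) // => f /=; rewrite sigma_poly.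
Qed.

(** The trace and the norm of an integral [(f + g s) / d] are polynomials. The trace gives [d | f],
    as 2 is invertible; the norm then gives [d^2 | D g^2], hence [d | g] because [D] is
    square-free. *)
Lemma OK_elt x : OK x <-> exists f g, x = elt f g.
Proof.
split=> [ix | [f [g ->]]]; last first.
  apply: integral_add; first exact: integral_id.
  apply: integral_mul; first exact: integral_id.
  exists ('X^2 - D%:P); first by rewrite monicXnsubC.
  rewrite rootE rmorphB /= map_polyXn map_polyC /= !hornerE.
  by have [-> _] := hs; rewrite subrr.
have [f [g [d [d0 e]]]] := elt_denom x.
have id0 : i_ d != 0 by rewrite polyK_eq0.
have ex : x = elt f g / i_ d by rewrite -e mulrC mulKf.
have esx : sigma x = elt f (- g) / i_ d by rewrite ex fmorph_div /= sigma_elt sigma_poly.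
have isx := integral_sigma ix.
have df : d %| f.
  suff : d %| 2%:R * f.
    by rewrite -polyC_natr mul_polyC dvdpZr.
  apply: integral_fraction => //; rewrite rmorphM rmorph_nat.
  have -> : 2%:R * i_ f / i_ d = x + sigma x.
    by rewrite esx ex -mulrDl elt_add subrr elt_poly rmorphD /= -mulr2n mulr_natl.
  exact: integral_add.
have dN : d ^+ 2 %| f ^+ 2 - D * g ^+ 2.
  apply: integral_fraction; first by rewrite expf_neq0.
  have -> : i_ (f ^+ 2 - D * g ^+ 2) / i_ (d ^+ 2) = x * sigma x.
    by rewrite esx ex mulf_div elt_norm rmorphXn expr2.
  exact: integral_mul.
have dg : d ^+ 2 %| D * g ^+ 2.
  rewrite -(subKr (f ^+ 2) (D * g ^+ 2)) dvdp_sub //.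
  exact: dvdp_exp2r.
have {}dg : d %| g.
  pose h := gcdp g d.
  have h0 : h != 0 by rewrite gcdp_eq0 negb_and d0 orbT.
  have [g' [d' [eg ed cop]]] : exists g' d', [/\ g = g' * h, d = d' * h & coprimep d' g'].
    exists (g %/ h), (d %/ h); rewrite !divpK ?dvdp_gcdl ?dvdp_gcdr //.
    by rewrite coprimep_sym coprimep_div_gcd ?d0 ?orbT.
  move: dg; rewrite ed eg !exprMn (mulrA D) dvdp_mul2r ?expf_neq0 // Gauss_dvdpl; last first.
    by apply: coprimep_expl; apply: coprimep_expr.
  move=> /hsqf /eqP; rewrite size_poly_eq1 => d1.
  by rewrite dvdp_mul2r // (eqp_dvdl _ d1) dvd1p.
exists (f %/ d), (g %/ d); apply: (mulfI id0).
rewrite e -(elt_poly d) elt_mul mulr0 !mul0r !addr0.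
by rewrite ![d * _]mulrC !divpK.
Qed.

End Coordinates.

(** * Ideals of the ring of integers *)

Section Ideals.
Local Open Scope classical_set_scope.
Variables (F : fieldType) (K : fieldExtType {fraction {poly F}}).
Implicit Types (x y z : K) (I J M : set K).
Local Notation O := (@OK F K).

Lemma OK0 : O 0. Proof. exact: integral0. Qed.
Lemma OK1 : O 1. Proof. exact: integral1. Qed.
Lemma OKD x y : O x -> O y -> O (x + y). Proof. exact: integral_add. Qed.
Lemma OKM x y : O x -> O y -> O (x * y). Proof. exact: integral_mul. Qed.
Lemma OK_polyK f : O (polyK K f). Proof. exact: integral_id. Qed.

Lemma OK_submodule_OK : OK_submodule O.
Proof. by split; [exact: OK0 | exact: OKD | exact: OKM]. Qed.

Lemma ideal_mul_mem I J x y : I x -> J y -> ideal_mul I J (x * y).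
Proof.
move=> Ix Jy; exists [:: (x, y)]; last by rewrite big_seq1.
by move=> w; rewrite inE => /eqP ->.
Qed.

(** The induction principle for products. Taking for [M] a preimage under a multiplication or under
    [sigma] avoids all manipulation of sums. *)
Lemma ideal_mul_subset I J M : M 0 -> (forall x y, M x -> M y -> M (x + y)) ->
  (forall x y, I x -> J y -> M (x * y)) -> ideal_mul I J `<=` M.
Proof.
move=> M0 MD MIJ _ [u uIJ ->]; elim: u uIJ => [|w u IHu] uIJ; first by rewrite big_nil.
rewrite big_cons; apply: MD; last by apply: IHu => v vu; apply: uIJ; rewrite inE vu orbT.
by have [Iw Jw] := uIJ w (mem_head _ _); apply: MIJ.
Qed.

Lemma ideal_mul0 I J : ideal_mul I J 0.
Proof. by exists [::]; rewrite ?big_nil. Qed.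

Lemma ideal_mulD I J x y : ideal_mul I J x -> ideal_mul I J y -> ideal_mul I J (x + y).
Proof.
move=> [u uIJ ->] [v vIJ ->]; exists (u ++ v); last by rewrite big_cat.
by move=> w; rewrite mem_cat => /orP [/uIJ|/vIJ].
Qed.

Lemma ideal_mulC I J : ideal_mul I J = ideal_mul J I.
Proof.
by apply/seteqP; split; apply: ideal_mul_subset; rewrite ?ideal_mul0 //;
  do ?[exact: ideal_mul0 | exact: ideal_mulD]; move=> x y Ix Jy; rewrite mulrC;
  apply: ideal_mul_mem.
Qed.

Lemma ideal_mul_subA I J M : ideal_mul I (ideal_mul J M) `<=` ideal_mul (ideal_mul I J) M.
Proof.
apply: ideal_mul_subset; [exact: ideal_mul0 | exact: ideal_mulD |].
move=> x y Ix; move: y; apply: (ideal_mul_subset (M := fun y => _ (x * y))).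
- by rewrite mulr0; apply: ideal_mul0.
- by move=> y z; rewrite mulrDr; apply: ideal_mulD.
- by move=> y z Jy Mz; rewrite mulrA; apply/ideal_mul_mem => //; apply: ideal_mul_mem.
Qed.

Lemma ideal_mulA I J M : ideal_mul I (ideal_mul J M) = ideal_mul (ideal_mul I J) M.
Proof.
apply/seteqP; split; first exact: ideal_mul_subA.
rewrite ideal_mulC [ideal_mul I J]ideal_mulC [ideal_mul J M]ideal_mulC.
by rewrite [X in _ `<=` X]ideal_mulC; apply: ideal_mul_subA.
Qed.

Lemma ideal_mul_submodule I J : OK_submodule I -> OK_submodule (ideal_mul I J).
Proof.
move=> [_ _ IZ]; split; [exact: ideal_mul0 | exact: ideal_mulD |] => a x Oa.
move: x; apply: (ideal_mul_subset (M := fun y => _ (a * y))).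
- by rewrite mulr0; apply: ideal_mul0.
- by move=> y z; rewrite mulrDr; apply: ideal_mulD.
- by move=> y z Iy Jz; rewrite mulrA; apply: ideal_mul_mem => //; apply: IZ.
Qed.

Lemma principal_submodule x : OK_submodule (principal x).
Proof.
split.
- by exists 0; [exact: OK0 | rewrite mul0r].
- by move=> _ _ [a Oa <-] [b Ob <-]; exists (a + b); [exact: OKD | rewrite mulrDl].
- by move=> a _ Oa [b Ob <-]; exists (a * b); [exact: OKM | rewrite mulrA].
Qed.

Lemma principal1 : principal 1 = O.
Proof.
apply/seteqP; split=> [_ [a Oa <-]|a Oa]; first by rewrite mulr1.
by exists a; rewrite ?mulr1.
Qed.

Lemma principal_mem x : principal x x.
Proof. by exists 1; [exact: OK1 | rewrite mul1r]. Qed.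

Lemma ideal_mul_principal I x : OK_submodule I ->
  ideal_mul I (principal x) = [set x * y | y in I].
Proof.
move=> [I0 ID IZ]; apply/seteqP; split.
  apply: ideal_mul_subset.
  - by exists 0; rewrite ?mulr0.
  - by move=> _ _ [y Iy <-] [z Iz <-]; exists (y + z); [exact: ID | rewrite mulrDr].
  - by move=> y _ Iy [a Oa <-]; exists (a * y); [exact: IZ | ring].
by move=> _ [y Iy <-]; rewrite mulrC; apply: ideal_mul_mem => //; apply: principal_mem.
Qed.

Lemma ideal_mul1 I : OK_submodule I -> ideal_mul I O = I.
Proof.
move=> IM; rewrite -principal1 ideal_mul_principal //.
apply/seteqP; split=> [_ [y Iy <-]|y Iy]; first by rewrite mul1r.
by exists y; rewrite ?mul1r.
Qed.

Lemma principalM x y : ideal_mul (principal x) (principal y) = principal (x * y).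
Proof.
rewrite ideal_mul_principal; last exact: principal_submodule.
apply/seteqP; split=> [_ [_ [a Oa <-] <-]|_ [a Oa <-]].
  by exists a => //; ring.
by exists (a * x); [exists a | ring].
Qed.

Lemma ideal_class_eq I J x : x != 0 -> J = ideal_mul I (principal x) ->
  ideal_class I = ideal_class J.
Proof.
move=> x0 ->; apply/seteqP; split=> [_ [y /= y0 <-]|_ [y /= y0 <-]].
  exists (x^-1 * y); first by rewrite /= mulf_neq0 ?invr_eq0.
  by rewrite -ideal_mulA principalM mulrA divff // mul1r.
exists (x * y); first by rewrite /= mulf_neq0.
by rewrite -ideal_mulA principalM.
Qed.

Lemma ideal_class_eqP I J : OK_submodule I -> ideal_class I = ideal_class J ->
  exists2 x, x != 0 & I = ideal_mul J (principal x).
Proof.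
move=> IM e; have : ideal_class I I.
  by exists 1; [exact: oner_neq0 | rewrite principal1 ideal_mul1].
by rewrite e => -[x /= x0 <-]; exists x.
Qed.

Definition ideal_exp I n := iter n (ideal_mul I) O.

Lemma ideal_exp_submodule I n : OK_submodule I -> OK_submodule (ideal_exp I n).
Proof.
by case: n => [|n] IM; [exact: OK_submodule_OK | apply: ideal_mul_submodule].
Qed.

Lemma ideal_expD I m n : OK_submodule I ->
  ideal_exp I (m + n) = ideal_mul (ideal_exp I m) (ideal_exp I n).
Proof.
move=> IM; elim: m => [|m IHm].
  by rewrite add0n /= ideal_mulC ideal_mul1 //; apply: ideal_exp_submodule.
by rewrite addSn /= -/(ideal_exp I _) IHm ideal_mulA.
Qed.

Lemma ideal_exp_mul I J n :
  ideal_exp (ideal_mul I J) n = ideal_mul (ideal_exp I n) (ideal_exp J n).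
Proof.
elim: n => [|n IHn] /=; first by rewrite ideal_mul1 //; apply: OK_submodule_OK.
rewrite -/(ideal_exp _ _) IHn -!ideal_mulA; congr ideal_mul.
by rewrite !ideal_mulA; congr ideal_mul; rewrite ideal_mulC.
Qed.

Lemma ideal_exp_principal x n : ideal_exp (principal x) n = principal (x ^+ n).
Proof.
elim: n => [|n IHn] /=; first by rewrite principal1.
by rewrite -/(ideal_exp _ _) IHn principalM exprS.
Qed.

Lemma ideal_exp_subset I n : OK_submodule I -> I `<=` O -> ideal_exp I n `<=` O.
Proof.
move=> IM IO; elim: n => [//|n IHn] /=.
apply: ideal_mul_subset; [exact: OK0 | exact: OKD |].
by move=> x y /IO Ox /IHn; apply: OKM.
Qed.

Lemma ideal_exp_mem I n x : I x -> ideal_exp I n (x ^+ n).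
Proof.
move=> Ix; elim: n => [|n IHn]; first exact: OK1.
by rewrite exprS; apply: ideal_mul_mem.
Qed.

End Ideals.

(** * Finiteness of the class group *)

(* Pigeonhole on the top [M] coefficients of the two remainders. *)
Lemma simultaneous_small_multiple (F : finFieldType) (N x y : {poly F}) (M : nat) :
  N != 0 ->
  exists w : {poly F}, [/\ w != 0, (size w <= (2 * M).+1)%N,
    (size ((w * x) %% N)%R <= (size N).-1 - M)%N &
    (size ((w * y) %% N)%R <= (size N).-1 - M)%N].
Proof.
move=> N0.
pose top (z : {poly F}) := \row_(i < M) (z %% N)`_((size N).-1 - M + i).
pose f (w : 'rV[F]_(2 * M).+1) := (top (rVpoly w * x), top (rVpoly w * y)).
have small (z z' : {poly F}) : top z = top z' ->
    (size ((z - z') %% N)%R <= (size N).-1 - M)%N.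
  move=> /rowP e; apply/leq_sizeP => j hj.
  rewrite modpD modpN coefB.
  have [jM|jM] := ltnP (j - ((size N).-1 - M)) M.
    have := e (Ordinal jM); rewrite !mxE /= subnKC // => ->; exact: subrr.
  have z0 (u : {poly F}) : (u %% N)`_j = 0.
    apply: nth_default; have := ltn_modp u N; rewrite N0; move: hj jM; size_lia.
  by rewrite !z0 subrr.
(* With [q = #|F|], there are [q^(2 M + 1)] multipliers but only [q^(2 M)] pairs of top parts. *)
have /injectivePn [w1 [w2 w12 [ex ey]]] : ~~ injectiveb f.
  apply/negP => /injectiveP /leq_card; rewrite card_prod !card_mx !mul1n -expnD.
  rewrite leq_exp2l ?(finRing_gt1 F) //; lia.
exists (rVpoly w1 - rVpoly w2); split.
- by rewrite subr_eq0 (can_eq rVpolyK).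
- by rewrite -raddfB /= size_poly.
- by rewrite mulrBl; apply: small.
- by rewrite mulrBl; apply: small.
Qed.

Section Finiteness.
Local Open Scope classical_set_scope.
Variables (F : finFieldType) (K : fieldExtType {fraction {poly F}}).
Variables (D : {poly F}) (s : K).
Hypothesis hns : ~ exists Q : {poly F}, D = Q ^+ 2.
Hypothesis hs : generated_by_sqrt D s.
Hypothesis OKE : forall x, @OK F K x <-> exists f g, x = elt s f g.
Implicit Types (x y : K) (I J : set K).

Let nrm (f g : {poly F}) := f ^+ 2 - D * g ^+ 2.

Let nrm_neq0 (f g : {poly F}) : elt s f g != 0 -> nrm f g != 0.
Proof.
apply: contraNneq => /eqP; rewrite subr_eq0 => /eqP /(norm_eq0 hns) [-> ->].
by rewrite /elt !rmorph0 mul0r addr0.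
Qed.

Let nrm_small (M : nat) (f g : {poly F}) (d : nat) : (size D <= M)%N -> (size f <= d - M)%N -> (size g <= d - M)%N ->
  (0 < size (nrm f g)%R)%N -> ((size (nrm f g)%R) + M <= 2 * d)%N.
Proof.
(* The subtraction [d - M] is truncated: for [d <= M] both coordinates vanish, and so does the
   norm. *)
move=> hD hf hg; have [dM|dM] := leqP d M.
  have f0 : f = 0 by apply/eqP; rewrite -size_poly_eq0; lia.
  have g0 : g = 0 by apply/eqP; rewrite -size_poly_eq0; lia.
  by rewrite /nrm f0 g0 !expr2 !mulr0 subrr size_poly0.
move=> _; suff : (size (nrm f g)%R <= 2 * (d - M) + M)%N by lia.
apply: leq_trans (size_polyD _ _) _; rewrite size_polyN geq_max.
have sq (h : {poly F}) : (size h <= d - M)%N -> (size (h ^+ 2)%R <= 2 * (d - M))%N.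
  by move=> hh; rewrite expr2; apply: leq_trans (size_polyMleq _ _) _; lia.
rewrite (leq_trans (sq f hf)) ?leq_addr //.
apply: leq_trans (size_polyMleq _ _) _; have := sq g hg; size_lia.
Qed.

(** Hurwitz's substitute for Euclidean division. If [alpha] has least norm [N], the coordinates of
    [b / alpha] are [x / N] and [y / N]. A multiplier [w] making both remainders modulo [N] small
    leaves [w b - alpha k] in [I] with norm smaller than [N], so it is zero. *)
Lemma bounded_denominator I : OK_submodule I -> I `<=` @OK F K ->
    (exists2 x, I x & x != 0) ->
  exists alpha, [/\ I alpha, alpha != 0 & forall b, I b ->
    exists w : {poly F}, [/\ w != 0, (size w <= (2 * size D).+1)%N &
      exists2 k, OK k & polyK K w * b = alpha * k]].
Proof.
move=> [I0 ID IZ] IO [x0 Ix0 x00].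
pose P n := `[< exists f g, [/\ I (elt s f g), elt s f g != 0 & size (nrm f g) = n] >].
have exP : exists n, P n.
  have /OKE [f [g e]] := IO _ Ix0.
  by exists (size (nrm f g)); apply/asboolP; exists f, g; rewrite -e.
case: (ex_minnP exP) => n /asboolP [a1 [a2 [Ia a0 an]]] nmin.
exists (elt s a1 a2); split=> // b Ib.
have [b1 [b2 eb]] : exists f g, b = elt s f g by apply/OKE/IO.
have N0 := nrm_neq0 a0.
pose x := a1 * b1 - D * a2 * b2; pose y := a1 * b2 - a2 * b1.
have ebc : b * elt s a1 (- a2) = elt s x y.
  by rewrite eb (elt_mul hs) /x /y; congr elt; ring.
have [w [w0 hw hx hy]] := simultaneous_small_multiple x y (size D) N0.
exists w; split=> //.
set N := nrm a1 a2 in N0 an hx hy.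
pose q1 := (w * x) %/ N; pose q2 := (w * y) %/ N.
set r1 := (w * x) %% N in hx; set r2 := (w * y) %% N in hy.
exists (elt s q1 q2); first by apply/OKE; exists q1, q2.
pose c := polyK K w * b - elt s a1 a2 * elt s q1 q2.
have Ic : I c.
  rewrite /c -mulrN mulrC; apply: ID; first by rewrite mulrC; apply: IZ => //; apply: OK_polyK.
  rewrite mulrC; apply: IZ => //; apply/OKE; exists (- q1), (- q2).
  by rewrite elt_opp.
have ec : c * elt s a1 (- a2) = elt s r1 r2.
  rewrite /c mulrBl -mulrA ebc mulrAC (elt_norm hs) -/(nrm _ _) -/N.
  rewrite -!(elt_poly s) !(elt_mul hs) elt_opp elt_add.
  rewrite !mulr0 !mul0r !addr0.
  rewrite {1}(divp_eq (w * x) N) {1}(divp_eq (w * y) N) -/q1 -/q2 -/r1 -/r2.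
  by congr elt; ring.
apply/eqP; rewrite -subr_eq0 -/c; apply/negPn/negP => c0.
have [g1 [g2 eg]] : exists f g, c = elt s f g by apply/OKE/IO.
have gN : nrm g1 g2 * N = nrm r1 r2.
  have := ec; rewrite eg (elt_mul hs) => /(elt_inj hns hs) [<- <-].
  by rewrite /N /nrm; ring.
have G0 : nrm g1 g2 != 0 by apply: nrm_neq0; rewrite -eg.
have Gmin : (n <= size (nrm g1 g2))%N.
  by apply: nmin; apply/asboolP; exists g1, g2; rewrite -eg.
have R0 : (0 < size (nrm r1 r2)%R)%N by rewrite -gN size_poly_gt0 mulf_neq0.
have := nrm_small (leqnn _) hx hy R0; rewrite -gN size_mul // an.
have : size D != 0%N.
  by rewrite size_poly_eq0; apply/negP => /eqP D0; apply: hns; exists 0; rewrite expr2 mulr0.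
have : (0 < n)%N by rewrite -an size_poly_gt0.
size_lia.
Qed.

(** A common multiple of all the multipliers [w] that [bounded_denominator] can produce. *)
Let denom : {poly F} :=
  \prod_(w : 'rV[F]_(2 * size D).+1 | rVpoly w != 0) rVpoly w.

Let denom_neq0 : denom != 0.
Proof. exact/prodf_neq0. Qed.

Let denom_dvd (w : {poly F}) : w != 0 -> (size w <= (2 * size D).+1)%N -> w %| denom.
Proof.
move=> w0 hw; rewrite /denom (bigD1 (poly_rV w)) /= poly_rV_K //.
exact: dvdp_mulIl.
Qed.

(** Representatives of O_K modulo [denom]. A submodule of O_K containing [denom] is a union of
    residue classes, so a subset of this finite type determines it. *)
Let residue := ('rV[F]_(size denom) * 'rV[F]_(size denom))%type.
Let rep (r : residue) : K := elt s (rVpoly r.1) (rVpoly r.2).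

Let saturation (S : {set residue}) : set K :=
  [set x | exists2 r, r \in S & exists2 k, OK k & x = rep r + polyK K denom * k].

Lemma saturation_surj I : OK_submodule I -> I `<=` @OK F K -> I (polyK K denom) ->
  exists S, I = saturation S.
Proof.
move=> [I0 ID IZ] IO IW; exists [set r | `[< I (rep r) >]]%SET.
apply/seteqP; split=> [x Ix|_ [r + [k Ok ->]]]; last first.
  rewrite inE => /asboolP Ir; apply: ID => //; rewrite mulrC; exact: IZ.
have [f [g ex]] : exists f g, x = elt s f g by apply/OKE/IO.
pose k := elt s (f %/ denom) (g %/ denom).
have Ok : OK k by apply/OKE; exists (f %/ denom), (g %/ denom).
pose r : residue := (poly_rV (f %% denom), poly_rV (g %% denom)).
have er : rep r = elt s (f %% denom) (g %% denom).
  by rewrite /rep !poly_rV_K //; apply: ltnW; rewrite ltn_modp denom_neq0.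
have exr : x = rep r + polyK K denom * k.
  rewrite ex er -(elt_poly s) (elt_mul hs) elt_add {1}(divp_eq f denom) {1}(divp_eq g denom).
  by congr elt; ring.
exists r; last by exists k.
rewrite inE; apply/asboolP.
have -> : rep r = x + (- k) * polyK K denom by rewrite exr; ring.
apply: ID => //; apply: IZ => //; apply/OKE.
by exists (- (f %/ denom)), (- (g %/ denom)); rewrite elt_opp.
Qed.

(* Scaling an ideal by [denom / alpha], with [alpha] a nonzero element of least
   norm, puts it between [denom O_K] and [O_K], where only finitely many
   submodules fit. *)
Lemma class_group_finite : finite_set (@class_group F K).
Proof.
apply: (@sub_finite_set _ _ [set ideal_class (saturation S) | S in setT]); last first.
  by apply: finite_image; apply: finite_finset.
move=> _ [I [IM [x1 Ix1 x10] [d Od [d0 Id]]] <-].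
have [J0M J0O J0n] : [/\ OK_submodule (ideal_mul I (principal d)),
    ideal_mul I (principal d) `<=` @OK F K &
    exists2 x, ideal_mul I (principal d) x & x != 0].
  split; first exact: ideal_mul_submodule.
    by rewrite ideal_mul_principal // => _ [y /Id Iy <-].
  exists (x1 * d); last by rewrite mulf_neq0.
  by apply: ideal_mul_mem => //; apply: principal_mem.
have [a [Ja a0 amul]] := bounded_denominator J0M J0O J0n.
pose c := polyK K denom / a.
have c0 : c != 0 by rewrite mulf_neq0 ?invr_eq0 ?polyK_eq0 ?denom_neq0.
have [||| S eS] := @saturation_surj (ideal_mul (ideal_mul I (principal d)) (principal c)).
- exact: ideal_mul_submodule.
- rewrite ideal_mul_principal // => _ [b /amul [w [w0 hw [k Ok e]]] <-].
  (* From [w b = a k] and [w | denom], the scaled element [denom b / a] is [(denom / w) k]. *)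
  have eW := divpK (denom_dvd w0 hw); set q := denom %/ w in eW.
  have -> : c * b = polyK K q * k.
    rewrite /c -eW rmorphM /= mulrAC -(mulrA (polyK K q)) e.
    by rewrite (mulrC a) mulrA mulfK.
  by apply: OKM => //; apply: OK_polyK.
- by rewrite ideal_mul_principal //; exists a => //; rewrite divfK.
exists S => //; rewrite -eS.
rewrite -(@ideal_class_eq _ _ (ideal_mul I (principal d)) _ c c0 erefl).
exact/esym/(@ideal_class_eq _ _ I _ d d0).
Qed.

End Finiteness.

(** * Powers of a split prime *)

Section SplitPrime.
Local Open Scope classical_set_scope.
Variables (F : fieldType) (K : fieldExtType {fraction {poly F}}).
Variables (D : {poly F}) (s : K).
Hypotheses (two : (2%:R : F) != 0) (hsqf : squarefree D).
Hypothesis hns : ~ exists Q : {poly F}, D = Q ^+ 2.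
Hypothesis hs : generated_by_sqrt D s.
Implicit Types (x y : K) (I J : set K).
Local Notation i_ := (@polyK F K).

(** The image of [s] is again a square root of [D]; were it [s] itself, [sigma] would be the
    identity, since it fixes F(T). *)
Lemma kAut_conjugation (sigma : 'End(K)) :
    kAut 1 fullv sigma -> sigma != \1%VF ->
  exists2 sg : {rmorphism K -> K}, (sigma =1 sg) &
    (forall f, sg (i_ f) = i_ f) /\ sg s = - s.
Proof.
rewrite kAutfE => hsg hn1; have hah : ahom_in {:K} sigma by rewrite -k1HomE.
pose sg : {rmorphism K -> K} := AHom hah.
have e : sigma =1 sg by [].
have fix_poly f : sg (i_ f) = i_ f.
  by rewrite -e; have [fixp _] := kHomP_tmp hsg; apply: fixp; rewrite rpredZ ?mem1v.
exists sg => //; split=> //.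
have [hs2 _] := hs.
have /eqP : sg s ^+ 2 = s ^+ 2 by rewrite -rmorphXn hs2; apply: fix_poly.
rewrite eqf_sqr => /orP [/eqP es|/eqP //].
case/negP: hn1; apply/eqP/lfunP => x; rewrite id_lfunE e.
have [f [h [d [d0 ed]]]] := elt_denom hs x.
have id0 : i_ d != 0 by rewrite polyK_eq0.
apply: (mulfI id0); rewrite -{1}(fix_poly d) -rmorphM ed.
by rewrite /elt rmorphD rmorphM /= !fix_poly es.
Qed.

Variable sigma : {rmorphism K -> K}.
Hypotheses (sigma_poly : forall f, sigma (i_ f) = i_ f) (sigma_s : sigma s = - s).

Let OKE x : @OK F K x <-> exists f g, x = elt s f g.
Proof. exact: (OK_elt two hsqf hs sigma_poly sigma_s). Qed.

Lemma sigmaK x : OK x -> sigma (sigma x) = x.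
Proof.
by move=> /OKE [f [g ->]]; rewrite !(sigma_elt sigma_poly sigma_s) opprK.
Qed.

Lemma sigma_OK : sigma @` (@OK F K) = @OK F K.
Proof.
apply/seteqP; split=> [_ [x Ox <-]|x Ox]; first exact: integral_sigma.
by exists (sigma x); [exact: integral_sigma | exact: sigmaK].
Qed.

Lemma sigma_ideal_mul I J :
  sigma @` (ideal_mul I J) = ideal_mul (sigma @` I) (sigma @` J).
Proof.
apply/seteqP; split.
  move=> _ [x + <-]; move: x; apply: (ideal_mul_subset (M := fun y => _ (sigma y))).
  - by rewrite rmorph0; apply: ideal_mul0.
  - by move=> x y; rewrite rmorphD; apply: ideal_mulD.
  - by move=> x y Ix Jy; rewrite rmorphM; apply: ideal_mul_mem; [exists x | exists y].
apply: ideal_mul_subset.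
- by exists 0; [exact: ideal_mul0 | exact: rmorph0].
- by move=> _ _ [x Ix <-] [y Jy <-]; exists (x + y); [exact: ideal_mulD | exact: rmorphD].
- by move=> _ _ [x Ix <-] [y Jy <-]; exists (x * y); [exact: ideal_mul_mem | exact: rmorphM].
Qed.

Lemma sigma_ideal_exp I n : sigma @` (ideal_exp I n) = ideal_exp (sigma @` I) n.
Proof.
elim: n => [|n IHn] /=; first exact: sigma_OK.
by rewrite sigma_ideal_mul -/(ideal_exp I n) IHn.
Qed.

Lemma sigma_principal x : sigma @` (principal x) = principal (sigma x).
Proof.
apply/seteqP; split=> [_ [_ [a Oa <-] <-]|_ [a Oa <-]].
  by exists (sigma a); [exact: integral_sigma | rewrite rmorphM].
exists (sigma a * x); first by exists (sigma a) => //; exact: integral_sigma.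
by rewrite rmorphM /= sigmaK.
Qed.

Lemma principal_dvdp f g : principal (i_ g) (i_ f) -> g %| f.
Proof.
move=> [a /OKE [u [v ->]]]; rewrite -!(elt_poly s) (elt_mul hs) mulr0 addr0.
by move=> /(elt_inj hns hs) [<- _]; apply: dvdp_mull.
Qed.

Variables (P : {poly F}) (p : set K).
Hypotheses (pprime : prime_ideal p) (qprime : prime_ideal (sigma @` p)).
Hypothesis pq : p <> sigma @` p.
Hypothesis hP : principal (i_ P) = ideal_mul p (sigma @` p).
Hypothesis P0 : P != 0.

(** With [p' = sigma p], the norm generates [p^n p'^n = (P^n)]. If [P] divided [f] and [g], then
    [alpha] would lie in [(P)], hence in [p']; so [p^n] would lie in [p'], and [p] too by primality.
    This avoids unique factorization of ideals. *)
Lemma principal_prime_power n alpha : (0 < n)%N ->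
    ideal_exp p n = principal alpha ->
  exists f g : {poly F}, f ^+ 2 - D * g ^+ 2 %= P ^+ n /\ ~ (P %| f /\ P %| g).
Proof.
move=> n0 en; have [pM pO _ _] := pprime; have [qM qO _ qP] := qprime.
have [f [g ea]] : exists f g, alpha = elt s f g.
  by apply/OKE; apply: (ideal_exp_subset (n := n) pM pO); rewrite en; apply: principal_mem.
exists f, g; split.
  have eN : principal (i_ (f ^+ 2 - D * g ^+ 2)) = principal (i_ (P ^+ n)).
    rewrite -(elt_norm hs) -(sigma_elt sigma_poly sigma_s) -ea -principalM.
    rewrite -sigma_principal -en sigma_ideal_exp -ideal_exp_mul -hP.
    by rewrite ideal_exp_principal -rmorphXn.
  apply/andP; split; apply: principal_dvdp; first by rewrite eN; apply: principal_mem.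
  by rewrite -eN; apply: principal_mem.
move=> [/divpK ef /divpK eg].
have aq : (sigma @` p) alpha.
  have : principal (i_ P) alpha.
    exists (elt s (f %/ P) (g %/ P)); first by apply/OKE; exists (f %/ P), (g %/ P).
    by rewrite ea -(elt_poly s) (elt_mul hs) !mulr0 add0r addr0 ef eg.
  have [q0 qD qZ] := qM.
  rewrite hP; apply: ideal_mul_subset => // x y px qy; apply: qZ => //; exact: pO.
have sub : p `<=` sigma @` p.
  move=> x px; have [q0 qD qZ] := qM.
  have : (sigma @` p) (x ^+ n).
    have : ideal_exp p n (x ^+ n) by exact: ideal_exp_mem.
    by rewrite en => -[a Oa <-]; apply: qZ.
  have Ox := pO _ px.
  case: n n0 {en} => // n _; elim: n => [|n IHn]; first by rewrite expr1.
  have Oxn : OK (x ^+ n.+1) by elim: n.+1 => [|k IHk]; [exact: OK1 | rewrite exprS; apply: OKM].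
  by rewrite exprS => /(qP _ _ Ox Oxn) [].
(* Applying the involution [sigma] to the inclusion yields the reverse one. *)
apply: pq; apply/seteqP; split=> // _ [x px <-].
have [y py e] := sub _ px.
by rewrite -e sigmaK //; apply: pO.
Qed.

Lemma prime_power_fractional n : fractional_ideal (ideal_exp p n).
Proof.
have [pM pO _ _] := pprime; have [qM qO _ _] := qprime.
split; first exact: ideal_exp_submodule.
  exists (i_ P ^+ n); last by rewrite expf_neq0 ?polyK_eq0.
  apply: ideal_exp_mem; have : principal (i_ P) (i_ P) by exact: principal_mem.
  have [p0 pD pZ] := pM.
  rewrite hP; apply: ideal_mul_subset => // x y px qy; rewrite mulrC; apply: pZ => //.
  exact: qO.
exists 1; first exact: OK1.
split; first exact: oner_neq0.
by move=> x; rewrite mul1r; apply: ideal_exp_subset.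
Qed.

(** The factor [p^i] is cancelled by its explicit inverse [P^(-i) p'^i], where [p' = sigma p]. *)
Lemma prime_power_class_eq i j : (i < j)%N ->
    ideal_class (ideal_exp p i) = ideal_class (ideal_exp p j) ->
  exists alpha, ideal_exp p (j - i) = principal alpha.
Proof.
move=> ij /esym e; have [pM _ _ _] := pprime; have [qM _ _ _] := qprime.
have [x x0 ex] := ideal_class_eqP (ideal_exp_submodule j pM) e.
exists x.
have ePi : ideal_mul (ideal_exp p i) (ideal_exp (sigma @` p) i) = principal (i_ (P ^+ i)).
  by rewrite -ideal_exp_mul -hP ideal_exp_principal -rmorphXn.
have /(congr1 (fun I => ideal_mul I (principal (i_ (P ^+ i))^-1))) :
    ideal_mul (ideal_exp p (j - i)) (principal (i_ (P ^+ i))) =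
    ideal_mul (principal x) (principal (i_ (P ^+ i))).
  rewrite -ePi !ideal_mulA -ideal_expD // subnK; last exact: ltnW.
  by rewrite ex [ideal_mul (principal x) _]ideal_mulC.
rewrite -!ideal_mulA principalM divff ?polyK_eq0 ?expf_neq0 // principal1.
by rewrite !ideal_mul1 //; [exact: principal_submodule | exact: ideal_exp_submodule].
Qed.

Lemma prime_power_principal : finite_set (@class_group F K) ->
  exists n alpha, [/\ (0 < n)%N, (n <= class_number K)%N & ideal_exp p n = principal alpha].
Proof.
move=> fin; pose c n := ideal_class (ideal_exp p n).
set h := class_number K.
have : ~~ uniq [seq c n | n <- iota 0 h.+1].
  apply/negP => /uniq_leq_size - /(_ (fset_set (@class_group F K))).
  rewrite size_map size_iota ltnn => H; suff: false by []; apply: H.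
  move=> _ /mapP [n _ ->]; rewrite in_fset_set // inE.
  by exists (ideal_exp p n) => //; exact: prime_power_fractional.
move=> /(uniqPn (c 0%N)) [i [j [ij]]]; rewrite size_map size_iota => jh.
rewrite !(nth_map 0%N) ?size_iota ?nth_iota ?add0n // ?(ltn_trans ij) //.
move=> e; have [a ea] := prime_power_class_eq ij e.
exists (j - i)%N, a; split=> //; first by rewrite subn_gt0.
by rewrite (leq_trans (leq_subr _ _)).
Qed.

End SplitPrime.

(** * From the norm gap to the degree bound *)

Lemma irreducible_dvdp_sqr (F : fieldType) (P g : {poly F}) :
  irreducible_poly P -> P %| g ^+ 2 -> P %| g.
Proof.
move=> [P1 Pirr] Pg2; have [cop|ncop] := boolP (coprimep P g).
  have /coprimepP/(_ P (dvdpp _) Pg2) : coprimep P (g ^+ 2) by exact: coprimep_expr.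
  by rewrite -size_poly_eq1 => /eqP e; rewrite e in P1.
have /Pirr/(_ (dvdp_gcdl _ _)) : size (gcdp P g) != 1%N by [].
by move=> /eqp_dvdl <-; apply: dvdp_gcdr.
Qed.

(** If [n deg P < d], the gap makes [P^n] associated with some [h^2]; as [n > 0], [P] divides [h]
    and therefore both [f] and [g]. *)
Lemma norm_gap_prime_power (F : fieldType) (d n : nat) (D P f g : {poly F}) :
    norm_gap d D -> irreducible_poly P -> (0 < n)%N ->
    f ^+ 2 - D * g ^+ 2 %= P ^+ n -> ~ (P %| f /\ P %| g) ->
  (d <= n * deg P)%N.
Proof.
move=> gap Pirr n0 eN nP; have [P1 _] := Pirr.
have szP : size P = (deg P).+1 by rewrite /deg (ltn_predK P1).
rewrite -ltnS -(size_expS n szP) -(eqp_size eN) ltnNge; apply/negP => hle.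
have N0 : f ^+ 2 - D * g ^+ 2 != 0.
  by rewrite -size_poly_eq0 (eqp_size eN) (size_expS _ szP).
have [h [hf hg eh]] := gap _ _ N0 hle.
have Ph : P %| h.
  apply: irreducible_dvdp_sqr => //; rewrite -(eqp_dvdr _ eh) (eqp_dvdr _ eN).
  by rewrite -(prednK n0) exprS dvdp_mulIl.
by apply: nP; split; apply: dvdp_trans Ph _.
Qed.

Lemma pchar_natr_eq0 (F : finFieldType) (p r l : nat) :
  prime p -> #|F| = (p ^ r)%N -> prime l -> (l%:R == 0 :> F) = (l == p).
Proof.
move=> hp hq hl; have pF := card_finPcharP hq hp.
by rewrite -(dvdn_pcharf pF) dvdn_prime2 // eq_sym.
Qed.

Theorem theorem3 (F : finFieldType) (p r : nat)
    (hp : prime p) (hpodd : odd p) (hr : (0 < r)%N) (hq : #|F| = (p ^ r)%N)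
    (a A : {poly F}) (ha : (0 < deg a)%N)
    (hA : A = 2%:R * a + 1) (hAmonic : A \is monic)
    (m : nat) (hm : (0 < m)%N)
    (D : {poly F})
    (hD : [\/ D = (A ^+ m + a) ^+ 2 + A,
              D = (A ^+ m - a) ^+ 2 + A,
              D = (A ^+ m + a + 1) ^+ 2 - A
            | D = (A ^+ m - a - 1) ^+ 2 - A])
    (* For p = 3, m = 1 the first form is D = A + 1, and the bound fails, e.g.
       for F = 'F_3, a = 2T^2 + 1, D = T^2 + 1, P = T, where h(D) = 1. *)
    (hexc : p = 3%N -> m = 1%N -> D <> (A ^+ m + a) ^+ 2 + A)
    (hsqf : squarefree D) (hreal : real_quadratic D)
    (K : fieldExtType {fraction {poly F}}) (s : K)
    (hK : generated_by_sqrt D s)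
    (P : {poly F}) (hirr : irreducible_poly P) (hsplit : splits K P) :
  (deg A)%:R / (deg P)%:R <= (class_number K)%:R :> rat.
Proof.
have [mD _ hns] := hreal; have [P1 _] := hirr.
have two : (2%:R : F) != 0.
  by rewrite (pchar_natr_eq0 hp hq) //; apply: contraTneq hpodd => <-.
have [dA gap] : (0 < deg A)%N /\ norm_gap (deg A) D.
  apply: (norm_gap_cases two ha hA hAmonic hm hD _ mD) => /eqP.
  by rewrite (pchar_natr_eq0 hp hq) // => /eqP /esym.
have [sigma0 [pp [[aut n1] [prim0 prim1] neq eP]]] := hsplit.
have [sigma e [sigma_poly sigma_s]] := kAut_conjugation hK aut n1.
have ei : image pp sigma0 = image pp sigma.
  by congr image; apply/funext => x; apply: e.
rewrite ei in prim1 neq eP.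
have P0 : P != 0 by rewrite -size_poly_gt0 (ltnW P1).
have OKE := OK_elt two hsqf hK sigma_poly sigma_s.
have fin := class_group_finite hns hK OKE.
have [n [alpha [n0 nh en]]] :=
  prime_power_principal prim0 prim1 eP P0 fin.
have [f [g [eN nP]]] := principal_prime_power two hsqf hns hK sigma_poly sigma_s
  prim0 prim1 neq eP n0 en.
have dn := norm_gap_prime_power gap hirr n0 eN nP.
have dP : (0 < deg P)%N by rewrite /deg -ltnS (ltn_predK P1).
rewrite ler_pdivrMr ?ltr0n // -natrM ler_nat.
by apply: leq_trans dn _; rewrite leq_mul2r nh orbT.
Qed.
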